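(* Let $z\in\mathbb{C}\setminus\{0,\frac14\}$. For each integer $n\ge0$, $$G_n(z)=\frac{2z^{\frac{n+1}{2}}}{\sqrt{4z-1}}\,\sin\!\left((n+1)\arccos\frac{1}{2\sqrt z}\right).$$
   Context: The polynomials $G_n$ are defined for $z\in\mathbb{C}$ by $G_0(z)=G_1(z)=1$ and $G_n(z)=G_{n-1}(z)-zG_{n-2}(z)$ for $n\ge 2$. Square roots and $\arccos$ are taken with their principal values (so that $\sin\arccos w=\sqrt{1-w^2}$), and $z^{\frac{n+1}{2}}=(\sqrt z)^{n+1}$. *)

(* Defs.v *)
From mathcomp Require Import all_boot all_order all_algebra.
From mathcomp Require Import all_reals all_analysis.
From mathcomp Require Import complex.

Set Implicit Arguments.
Unset Strict Implicit.
Unset Printing Implicit Defensive.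

Import Order.TTheory GRing.Theory Num.Theory.

Local Open Scope ring_scope.
Local Open Scope complex_scope.

Section Defs.
Variable R : realType.
Implicit Types (z w : R[i]) (n : nat).

Definition cexp z : R[i] :=
  (expR (complex.Re z))%:C * (cos (complex.Im z) +i* sin (complex.Im z)).

(* acos takes values in [0, pi], so carg z lies in ]-pi, pi]; a negative real
   has argument pi. *)
Definition carg z : R :=
  let t := acos (complex.Re z / ComplexField.Normc.normc z) in
  if 0 <= complex.Im z then t else - t.

(* Principal logarithm, with the cut along the nonpositive real axis; the value
   at 0 is junk. *)
Definition clog z : R[i] := ln (ComplexField.Normc.normc z) +i* carg z.

Definition csin z : R[i] :=
  (cexp ('i * z) - cexp (- ('i * z))) / (2 * 'i).

(* The library's sqrtc is the principal square root: its real part is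
   nonnegative, and it maps a real x < 0 to 'i * sqrt |x|.  The argument of
   clog never vanishes, since it times w - 'i * sqrtc (1 - w ^+ 2) is 1.  On
   the cuts this takes the usual values: cacos x is 'i * ln (x + sqrt (x^2 - 1))
   for x > 1, and pi - 'i * ln (- x + sqrt (x^2 - 1)) for x < -1. *)
Definition cacos w : R[i] :=
  - 'i * clog (w + 'i * sqrtc (1 - w ^+ 2)).

Fixpoint G n z : R[i] :=
  match n with
  | (m.+1 as k).+1 => G k z - z * G m z
  | _ => 1
  end.

End Defs.

(* Main.v *)
(** Put [w = 1 / (2 sqrt z)] and [u = w + i sqrt (1 - w^2)], so that
    [exp (i arccos w) = u] and [sin ((n+1) arccos w)] is
    [(u^(n+1) - u^-(n+1)) / 2i].  The numbers [a = sqrt z * u] and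
    [b = sqrt z / u] satisfy [a + b = 1] and [a b = z], whence
    [a^(n+1) - b^(n+1) = (a - b) G_n].  It remains to see that
    [a - b = 2i sqrt z sqrt (1 - w^2)] equals [i sqrt (4z - 1)].  Both sides
    have the same square, so this is a question of branches: it holds because
    the product of the principal roots of [4z] and [1 - 1/(4z)] is again a
    principal root. *)

Require Import Defs.
From mathcomp Require Import all_boot all_order all_algebra.
From mathcomp Require Import all_reals all_analysis.
From mathcomp Require Import complex ring lra.

Import Order.TTheory GRing.Theory Num.Theory.

Local Open Scope ring_scope.
Local Open Scope complex_scope.

Lemma cexpD (R : realType) (x y : R[i]) : cexp (x + y) = cexp x * cexp y.
Proof.
case: x y => [a b] [c d]; rewrite /cexp /= expRD cosD sinD.
by apply/eqP; rewrite eq_complex /=; apply/andP; split; apply/eqP; ring.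
Qed.

Lemma cexp0 (R : realType) : cexp (0 : R[i]) = 1.
Proof.
apply/eqP; rewrite /cexp /= expR0 cos0 sin0 eq_complex /=.
by rewrite !mulr0 !mul0r subr0 addr0 mulr1 !eqxx.
Qed.

Lemma cexpN (R : realType) (x : R[i]) : cexp (- x) = (cexp x)^-1.
Proof.
have e : cexp x * cexp (- x) = 1 by rewrite -cexpD subrr cexp0.
have nz : cexp x != 0.
  by apply/eqP => x0; move/eqP: e; rewrite x0 mul0r eq_sym oner_eq0.
by apply: (mulfI nz); rewrite e mulfV.
Qed.

Lemma cexpX (R : realType) (x : R[i]) n : cexp (n%:R * x) = cexp x ^+ n.
Proof.
elim: n => [|n IH]; first by rewrite mul0r cexp0.
by rewrite -natr1 mulrDl mul1r cexpD IH exprSr.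
Qed.

(** [acos] yields an angle with the right cosine [a / r] and the nonnegative sine [|b| / r]; the
    sign chosen in [carg] then turns [|b|] into [b]. *)
Lemma clogK (R : realType) (u : R[i]) : u != 0 -> cexp (clog u) = u.
Proof.
case: u => [a b]; rewrite eq_complex /= => ab0.
set r := Num.sqrt (a ^+ 2 + b ^+ 2).
have s_gt0 : 0 < a ^+ 2 + b ^+ 2.
  rewrite lt_neqAle eq_sym addr_ge0 ?sqr_ge0 // andbT.
  by rewrite paddr_eq0 ?sqr_ge0 // !sqrf_eq0.
have r_gt0 : 0 < r by rewrite sqrtr_gt0.
have rE : r ^+ 2 = a ^+ 2 + b ^+ 2 by rewrite sqr_sqrtr // ltW.
have cs1 : (a / r) ^+ 2 + (b / r) ^+ 2 = 1.
  by rewrite !expr_div_n -mulrDl -rE divff // expf_neq0 // gt_eqF.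
have arB : -1 <= a / r <= 1.
  by rewrite -ler_norml -(@ler_pXn2r _ 2) ?nnegrE // real_normK ?num_real //
     expr1n -cs1 lerDl sqr_ge0.
have sE : Num.sqrt (1 - (a / r) ^+ 2) = `|b| / r.
  by rewrite -cs1 addrAC subrr add0r sqrtr_sqr normrM normfV (gtr0_norm r_gt0).
rewrite /cexp /clog /carg /= -/r lnK ?posrE //.
apply/eqP; rewrite eq_complex /= !mul0r subr0 addr0.
have r0 : r != 0 by rewrite gt_eqF.
case: ifP => b0; rewrite ?cosN ?sinN acosK ?in_itv //= sin_acos // sE.
  by rewrite (ger0_norm b0) ![r * _]mulrC !divfK ?eqxx.
rewrite (ltr0_norm (_ : b < 0)); last by rewrite ltNge b0.
by rewrite mulNr opprK ![r * _]mulrC !divfK ?eqxx.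
Qed.

(** The range of the principal square root: it contains exactly one of [v] and [- v] for each
    nonzero [v]. *)
Definition principal {R : realType} (v : R[i]) : Prop :=
  0 < complex.Re v \/ complex.Re v = 0 /\ 0 <= complex.Im v.

Lemma principal_sqrtc (R : realType) (x : R[i]) : principal (sqrtc x).
Proof.
have /eqP := sqr_sqrtc x; case: x => a b.
rewrite expr2 eq_complex /principal /=.
set c := Num.sqrt _; set d := (if _ then _ else _) * _ => /andP[_ /eqP bE].
have [c0|c0] := eqVneq c 0; [right; split=> // | left].
  (* A zero real part of the root forces the radicand to be real, and the sign factor in [sqrtc] is
     1, not 0, at [b = 0]. *)
  have b0 : b = 0 by move: bE; rewrite c0 mul0r mulr0 addr0.
  by rewrite /d b0 eqxx mul1r sqrtr_ge0.
by rewrite lt_neqAle eq_sym c0 sqrtr_ge0.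
Qed.

(** Equal squares leave [v = w] or [v = - w], and the region meets its negative only at 0. *)
Lemma principal_inj (R : realType) (v w : R[i]) :
  principal v -> principal w -> v ^+ 2 = w ^+ 2 -> v = w.
Proof.
move=> pv pw /eqP; rewrite eqf_sqr => /orP[/eqP //|/eqP].
case: v w pv pw => [a b] [c d]; rewrite /principal /= => pv pw /eqP.
rewrite eq_complex /= => /andP[/eqP ac /eqP bd].
by apply/eqP; rewrite eq_complex /=; apply/andP; split; apply/eqP; lra.
Qed.

(** Subtracting 1 keeps the imaginary part of [p ^+ 2], so [p * q] and [p] have the same product of
    coordinates ([ef]). For [p] off the axes, this and [Re q >= 0], which keeps [p * q] within a
    right angle of [p], exclude the wrong branch. *)
Lemma principalM (R : realType) (p q : R[i]) : principal p -> principal q ->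
  (p * q) ^+ 2 = p ^+ 2 - 1 -> principal (p * q).
Proof.
case: p q => [x y] [c d] pp pq /eqP; rewrite eq_complex => /andP[].
move: pp pq; rewrite /principal !expr2 /=.
set e := x * c - y * d; set f := x * d + y * c => pp pq /eqP E1 /eqP E2.
have ef : e * f = x * y by lra.
case: pp => [x_gt0|[x0 y_ge0]].
  have [y0|y0] := eqVneq y 0.
    rewrite /e /f y0 !mul0r subr0 addr0.
    case: pq => [c_gt0|[-> d_ge0]]; [left | right].
      exact: mulr_gt0.
    by rewrite mulr0 mulr_ge0 // ltW.
  have exfy : 0 <= e * x + f * y.
    have -> : e * x + f * y = c * (x ^+ 2 + y ^+ 2) by rewrite /e /f; ring.
    by apply: mulr_ge0; [case: pq => [/ltW|[->]] | rewrite addr_ge0 ?sqr_ge0].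
  left; rewrite ltNge; apply/negP => e_le0.
  have y2 : 0 < y ^+ 2 by rewrite lt_neqAle eq_sym sqrf_eq0 y0 sqr_ge0.
  have : 0 < x * y ^+ 2 by rewrite mulr_gt0.
  (* The left side is positive, but [e <= 0] makes the right side nonpositive. *)
  have -> : x * y ^+ 2 = e * (e * x + f * y) - e ^+ 2 * x.
    by rewrite !mulrDr [e * (f * y)]mulrA ef; ring.
  rewrite ltNge subr_le0 => /negP; apply.
  apply: (@le_trans _ _ 0); first exact: mulr_le0_ge0.
  by rewrite mulr_ge0 ?sqr_ge0 // ltW.
have c_ge0 : 0 <= c by case: pq => [/ltW|[->]].
have fE : f = y * c by rewrite /f x0 mul0r add0r.
right; split; last by rewrite fE mulr_ge0.
(* A nonzero [e] would give [f = 0], and the real parts would then read [e ^+ 2 = - y ^+ 2 - 1]. *)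
apply/eqP/negPn/negP => e0.
have f0 : f = 0 by apply: (mulfI e0); rewrite ef x0 mul0r mulr0.
move: E1; rewrite f0 x0 !mulr0 => E1.
by have := sqr_ge0 e; have := sqr_ge0 y; rewrite !expr2; lra.
Qed.

Lemma sqrtc_branch (R : realType) (z : R[i]) : z != 0 ->
  2 * sqrtc z * sqrtc (1 - (1 / (2 * sqrtc z)) ^+ 2) = sqrtc (4 * z - 1).
Proof.
move=> z0; set s := sqrtc z.
have s2 : s ^+ 2 = z := sqr_sqrtc z.
have s0 : s != 0 by rewrite sqrtc_eq0.
have p2 : (2 * s) ^+ 2 = 4 * z by rewrite -s2; ring.
have pq2 : (2 * s * sqrtc (1 - (1 / (2 * s)) ^+ 2)) ^+ 2 = (2 * s) ^+ 2 - 1.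
  rewrite exprMn sqr_sqrtc; field.
  by rewrite s0.
apply: principal_inj; last by rewrite pq2 p2 sqr_sqrtc.
  apply: principalM pq2; last exact: principal_sqrtc.
  have := principal_sqrtc R z.
  rewrite -/s /principal mulr_natl mulr2n; case: (s) => a b /=.
  by lra.
exact: principal_sqrtc.
Qed.

(** [a] and [b] are the roots of [X^2 - X + a b], so their powers obey the recurrence of [G] at
    [a * b]. It has order two, hence the induction on pairs of consecutive indices. *)
Lemma subX_G (R : realType) (a b : R[i]) n : a + b = 1 ->
  a ^+ n.+1 - b ^+ n.+1 = (a - b) * G n (a * b).
Proof.
move=> ab1.
suff /(_ n) [] : forall m,
    a ^+ m.+1 - b ^+ m.+1 = (a - b) * G m (a * b)
    /\ a ^+ m.+2 - b ^+ m.+2 = (a - b) * G m.+1 (a * b) by [].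
elim=> [|m [IH0 IH1]].
  by split; rewrite /= mulr1 ?expr1 // subr_sqr ab1 mulr1.
split=> //; transitivity ((a + b) * (a ^+ m.+2 - b ^+ m.+2)
                          - a * b * (a ^+ m.+1 - b ^+ m.+1)).
  by rewrite !exprS; ring.
by rewrite ab1 IH0 IH1 /=; ring.
Qed.

Lemma csin_cacos (R : realType) (w : R[i]) n :
  csin (n%:R * cacos w) =
    ((w + 'i * sqrtc (1 - w ^+ 2)) ^+ n - (w - 'i * sqrtc (1 - w ^+ 2)) ^+ n)
    / (2 * 'i).
Proof.
set q := sqrtc _; set u := w + _; set u' := w - _.
have q2 : q ^+ 2 = 1 - w ^+ 2 := sqr_sqrtc _.
(* This gives both [u != 0], needed for [clogK], and [u' = u^-1]. *)
have uu' : u * u' = 1.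
  by rewrite /u /u' [_ * (_ - _)]mulrC -subr_sqr exprMn sqr_i q2; ring.
have u0 : u != 0.
  by apply/eqP => u_0; move/eqP: uu'; rewrite u_0 mul0r eq_sym oner_eq0.
have -> : u' = u^-1 by apply: (mulfI u0); rewrite uu' mulfV.
have uE : 'i * cacos w = clog u.
  by rewrite /cacos -/q -/u mulrA mulrN -expr2 sqr_i opprK mul1r.
by rewrite /csin mulrCA uE cexpN cexpX clogK // exprVn.
Qed.

Theorem corollary3 (R : realType) (z : R[i]) (hz0 : z != 0)
    (hz4 : z != 1 / 4) (n : nat) :
  G n z = 2 * sqrtc z ^+ n.+1 / sqrtc (4 * z - 1)
          * csin (n.+1%:R * cacos (1 / (2 * sqrtc z))).
Proof.
have := sqrtc_branch R z hz0; rewrite csin_cacos.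
set s := sqrtc z; set w := 1 / _; set q := sqrtc (1 - _); set r := sqrtc _.
move=> sq.
have s2 : s ^+ 2 = z := sqr_sqrtc z.
have s0 : s != 0 by rewrite sqrtc_eq0.
have q2 : q ^+ 2 = 1 - w ^+ 2 := sqr_sqrtc _.
(* Here [hz4] enters: [r] vanishes only at [z = 1 / 4]. *)
have r0 : r != 0.
  rewrite sqrtc_eq0 subr_eq0; apply: contraNneq hz4 => z4.
  have n4 : 4 != 0 :> R[i] by rewrite pnatr_eq0.
  by apply/eqP/(mulfI n4); rewrite z4 mulrCA divff ?mulr1.
have i0 : 'i != 0 :> R[i] by rewrite eq_complex /= oner_eq0 andbF.
have ws : s * w = 1 / 2 by rewrite /w; field; rewrite s0.
have ab1 : s * (w + 'i * q) + s * (w - 'i * q) = 1.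
  by rewrite !mulrDr ws; field.
have abz : s * (w + 'i * q) * (s * (w - 'i * q)) = z.
  rewrite mulrACA [_ * (_ - _)]mulrC -subr_sqr -expr2 s2.
  by rewrite [('i * q) ^+ 2]exprMn sqr_i q2; ring.
have amb : s * (w + 'i * q) - s * (w - 'i * q) = 'i * r.
  by rewrite -sq; ring.
have := subX_G R _ _ n ab1.
rewrite abz amb !exprMn => H.
(* Division by [a - b = 'i * r]; its ['i] matches the one in the denominator of [csin], and the
   factors 2 cancel. *)
have -> : G n z = (s ^+ n.+1 * (w + 'i * q) ^+ n.+1
                   - s ^+ n.+1 * (w - 'i * q) ^+ n.+1) / ('i * r).
  by rewrite H mulrAC divff ?mul1r // mulf_neq0.
by field; rewrite r0 i0.
Qed.
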